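(* Let $f:\mathbb{R}^n\to\mathbb{R}^n$ be a polynomial vector field with $f(0)=0$ and consider the system $\dot x=f(x)$. If there exists a continuously differentiable, radially unbounded function $V:\mathbb{R}^n\to\mathbb{R}$ that satisfies $\dot V(x)=\langle\nabla V(x),f(x)\rangle<0$ for all $x\neq 0$, then the origin is globally asymptotically stable.
   Context: A function $V:\mathbb{R}^n\to\mathbb{R}$ is radially unbounded if $V(x)\to\infty$ as $\|x\|\to\infty$. The origin is globally asymptotically stable for $\dot x=f(x)$ if it is stable in the sense of Lyapunov and every trajectory converges to the origin as $t\to\infty$. Note that $V$ is not assumed to be positive or to vanish at the origin. *)

(* Defs.v *)
From HB Require Import structures.
From mathcomp Require Import all_boot all_order all_algebra.
From mathcomp Require Import all_classical all_reals all_analysis.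
(* Not imported: the notations of mpoly clash with those of analysis. *)
From mathcomp Require mpoly.

Set Implicit Arguments.
Unset Strict Implicit.
Unset Printing Implicit Defensive.

Import Order.TTheory GRing.Theory Num.Theory numFieldNormedType.Exports.

Local Open Scope classical_set_scope.
Local Open Scope ring_scope.

(* Points of R^n are row vectors.  The library norm on 'rV[R]_n is the sup
   norm; radial unboundedness, stability and convergence do not depend on the
   choice of a norm on R^n. *)

Section VectorFields.
Variables (R : realType) (n : nat).
Implicit Types (f : 'rV[R]_n -> 'rV[R]_n) (V : 'rV[R]_n -> R).

Definition polynomial_field f : Prop :=
  exists p : 'I_n -> mpoly.mpoly n R,
    forall x i, f x ord0 i = mpoly.meval (fun j => x ord0 j) (p i).

Definition gradient V (x : 'rV[R]_n) : 'rV[R]_n :=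
  \row_(j < n) 'D_(delta_mx ord0 j) V x.

Definition continuously_differentiable V : Prop :=
  (forall x, differentiable V x) /\ continuous (gradient V).

Definition inner_product (u v : 'rV[R]_n) : R :=
  \sum_(i < n) u ord0 i * v ord0 i.

Definition orbital_derivative V f (x : 'rV[R]_n) : R :=
  inner_product (gradient V x) (f x).

Definition radially_unbounded V : Prop :=
  forall M : R, exists r : R, forall x, r <= `|x| -> M <= V x.

(* [x] solves x' = f(x) on [0, T[, where T may be +oo; the values of [x]
   outside [0, T[ are irrelevant.  At the endpoint 0 only continuity from the
   right is asked: for continuous f, the one-sided equation at 0 follows. *)
Definition solution f (T : \bar R) (x : R -> 'rV[R]_n) : Prop :=
  [/\ (0 < T)%E,
      {within [set t : R | 0 <= t /\ (t%:E < T)%E], continuous x} &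
      forall t : R, 0 < t -> (t%:E < T)%E -> is_derive t 1 x (f (x t))].

(* No solution on a strictly longer interval [0, T'[ extends [x]. *)
Definition maximal_solution f (T : \bar R) (x : R -> 'rV[R]_n) : Prop :=
  solution f T x /\
  forall (T' : \bar R) (y : R -> 'rV[R]_n),
    solution f T' y -> (T <= T')%E ->
    (forall t : R, 0 <= t -> (t%:E < T)%E -> y t = x t) -> T' = T.

Definition lyapunov_stable f : Prop :=
  forall e : R, 0 < e -> exists2 d : R, 0 < d &
    forall (T : \bar R) (x : R -> 'rV[R]_n),
      solution f T x -> `|x 0| < d ->
      forall t : R, 0 <= t -> (t%:E < T)%E -> `|x t| < e.

(* Trajectories are maximal solutions, so that convergence as t -> +oo
   includes the absence of finite-time blow-up.  The first conjunct prevents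
   the second from being vacuous. *)
Definition globally_attractive f : Prop :=
  forall x0 : 'rV[R]_n,
    (exists2 x : R -> 'rV[R]_n, solution f +oo%E x & x 0 = x0) /\
    (forall (T : \bar R) (x : R -> 'rV[R]_n),
       maximal_solution f T x -> x 0 = x0 ->
       T = +oo%E /\ x t @[t --> +oo] --> (0 : 'rV[R]_n)).

Definition globally_asymptotically_stable f : Prop :=
  lyapunov_stable f /\ globally_attractive f.

End VectorFields.

(* Main.v *)
Require Import Defs.
From mathcomp Require Import all_boot all_order all_algebra.
From mathcomp Require Import all_classical all_reals all_analysis.
From mathcomp Require mpoly.
From mathcomp Require Import ring lra.

(** The proof is Lyapunov's direct method, with two points to settle first:
    [V] is not assumed positive definite, and trajectories must be shown to
    exist for all times.

    Positivity.  Being continuous and radially unbounded, [V] attains a global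
    minimum.  There the orbital derivative vanishes, so that the minimum can
    only be at the origin: [V 0 < V x] for [x != 0] ([lyapunov_strict_min]).
    Consequently for each radius [e] there is a level [m > V 0] below which
    every point has norm less than [e] ([lyapunov_barrier]).  As [V] is
    nonincreasing along solutions, this gives stability.

    Existence and uniqueness.  A globally Lipschitz field has global solutions:
    Picard iteration contracts by 1/2 in the weight [expR (2 * L * t)] on the
    whole half-line ([picard_contraction], [picard_lindelof]).  The polynomial
    field [f] is not globally Lipschitz, but its product with a bump function
    equal to 1 on a ball is ([polynomial_cutoff]).  This product is a
    nonnegative multiple of [f], hence [V] still decreases along its
    trajectories; if the ball contains the sublevel set of [V x0], the
    trajectory from [x0] never leaves it and solves the original equation
    ([global_solution]).  The same contraction gives uniqueness, so that
    maximal solutions live forever ([unique_solution]).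

    Convergence.  If a trajectory never entered the set [V < m], it would stay
    in the compact set where [m <= V <= V (x 0)], which avoids the origin.  The
    orbital derivative is bounded above by some [- d < 0] there, and [V] would
    tend to minus infinity along the trajectory, although it is bounded below
    by [V 0] ([global_solution_cvg]). *)

Set Implicit Arguments.
Unset Strict Implicit.
Unset Printing Implicit Defensive.

Import Order.TTheory GRing.Theory Num.Theory numFieldNormedType.Exports.

Local Open Scope classical_set_scope.
Local Open Scope ring_scope.

(** * Row vectors and their coordinates *)

Section Coordinates.
Context {R : realType} {n : nat}.
Implicit Types x y : 'rV[R]_n.

Lemma ler_coord_norm x i : `|x ord0 i| <= `|x|.
Proof.
rewrite [leRHS]/Num.Def.normr/= mx_normrE.
exact: (le_bigmax _ (fun ij => `|x ij.1 ij.2|) (ord0, i)).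
Qed.

Lemma rV_norm_le x (c : R) :
  0 <= c -> (forall i, `|x ord0 i| <= c) -> `|x| <= c.
Proof.
move=> c0 xc; rewrite [leLHS]/Num.Def.normr/= mx_normrE.
by apply: bigmax_le => //= -[i j] _; rewrite (ord1 i).
Qed.

Lemma continuous_rV (T : topologicalType) (x : T -> 'rV[R]_n) :
  (forall i, continuous (fun t => x t ord0 i)) -> continuous x.
Proof.
move=> xc t; apply/cvgrPdist_le => e e0; near=> s.
apply: rV_norm_le; first exact: ltW.
move=> i; rewrite !mxE; move: i; near: s; apply: filter_forall => i.
exact: (proj1 (cvgrPdist_le _ _) (xc i t) e e0).
Unshelve. all: by end_near. Qed.

Lemma is_derive_rV (x : R -> 'rV[R]_n) (t : R) (v : 'rV[R]_n) :
  (forall i, is_derive t 1 (fun s => x s ord0 i) (v ord0 i)) ->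
  is_derive t 1 x v.
Proof.
move=> xv; have dx : derivable x t 1.
  by apply/derivable_mxP => i j; rewrite (ord1 i); have [] := xv j.
apply: DeriveDef => //; rewrite derive_mx//.
by apply/rowP => j; rewrite mxE; have [_ ->] := xv j.
Qed.

Lemma is_derive_coord (x : R -> 'rV[R]_n) (t : R) (v : 'rV[R]_n) i :
  is_derive t 1 x v -> is_derive t 1 (fun s => x s ord0 i) (v ord0 i).
Proof.
move=> [dx <-]; apply: DeriveDef.
  by move/derivable_mxP : dx; exact.
by rewrite derive_mx// mxE.
Qed.

End Coordinates.

(** * Primitives on [0, T[ and the halving estimate *)

Section Primitives.
Context {R : realType}.

Definition life (T : \bar R) : set R := [set t | 0 <= t /\ (t%:E < T)%E].

Lemma life_le {T : \bar R} {s t : R} : 0 <= s -> s <= t -> life T t -> life T s.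
Proof.
by move=> s0 st [_ tT]; split=> //; rewrite (le_lt_trans _ tT)// lee_fin.
Qed.

(** The format of the clause is that of [solution], so that a solution of
    [x' = f x] is exactly a primitive of [f \o x] on [life T]. *)
Definition primitive_on {W : normedModType R} (T : \bar R) (x w : R -> W) :=
  {within life T, continuous x} /\
  forall t : R, 0 < t -> life T t -> is_derive t 1 x (w t).

(** Mean value theorem; at the endpoint 0 only continuity is available. *)
Lemma le_of_derive_le0 (T : \bar R) (h dh : R -> R) (s t : R) :
  primitive_on T h dh -> (forall t, 0 < t -> life T t -> dh t <= 0) ->
  0 <= s -> s <= t -> life T t -> h t <= h s.
Proof.
move=> [ch Dh] dh0 s0; rewrite le_eqVlt => /predU1P[->//|st tT].
have Dst u : u \in `]s, t[ -> [/\ 0 < u, life T u & s < u].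
  rewrite in_itv/= => /andP[su ut]; split => //; first exact: le_lt_trans su.
  by apply: life_le tT; [exact: le_trans (ltW su)|exact: ltW].
have [| |c /Dst[c0 cT _] eq_h] := @MVT R h dh s t st.
- by move=> u /Dst[u0 uT _]; exact: Dh.
- apply: continuous_subspaceW ch => u/=; rewrite in_itv/= => /andP[su ut].
  by apply: life_le tT => //; exact: le_trans su.
by rewrite -subr_le0 eq_h mulr_le0_ge0 ?subr_ge0 ?(ltW st)// dh0.
Qed.

Lemma is_derive_expRM (L t : R) :
  is_derive t 1 (fun s => expR (L * s)) (L * expR (L * t)).
Proof.
have -> : (fun s => expR (L * s)) = expR \o ( *%R L) by [].
have dL : is_derive t 1 ( *%R L) L.
  by apply: is_derive_eq; rewrite /GRing.scale/= mulr1.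
by rewrite mulrC; exact: is_derive1_comp.
Qed.

(** The reason why Picard iteration contracts on an unbounded time interval:
    an error measured against the weight [expR (2 * L * t)] is halved when it
    is integrated after multiplication by the Lipschitz constant [L], because
    the primitive of [L * expR (2 * L * t)] is half the weight. *)
Lemma primitive_halving (T : \bar R) (h dh : R -> R) (L C : R) :
  primitive_on T h dh -> h 0 = 0 -> 0 <= C ->
  (forall t, 0 < t -> life T t -> `|dh t| <= L * (C * expR (2 * L * t))) ->
  forall t, life T t -> `|h t| <= C / 2 * expR (2 * L * t).
Proof.
have side (k dk : R -> R) : primitive_on T k dk -> k 0 = 0 -> 0 <= C ->
  (forall t, 0 < t -> life T t -> dk t <= L * (C * expR (2 * L * t))) ->
  forall t, life T t -> k t <= C / 2 * expR (2 * L * t).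
  move=> [ck Dk] k0 C0 dkC t tT.
  (* The derivative of [C / 2 * expR (2 * L * s)] is the bound on [dk]. *)
  pose q s := k s - C / 2 * expR (2 * L * s).
  pose dq s := dk s - C / 2 * (2 * L * expR (2 * L * s)).
  have : q t <= q 0.
    apply: (@le_of_derive_le0 T q dq) => //; last 2 first.
    - by move=> s s0 sT; rewrite /dq; have := dkC s s0 sT; lra.
    - by case: tT.
    split=> [s|s s0 sT].
      apply: cvgB; first exact: ck.
      apply: cvgM; first exact: cvg_cst.
      apply: continuous_subspaceT => u.
      apply: differentiable_continuous; apply/derivable1_diffP.
      by have [] := is_derive_expRM (2 * L) u.
    have ? := Dk s s0 sT; have ? := is_derive_expRM (2 * L) s.
    have -> : q = k - (C / 2) \*: (fun s => expR (2 * L * s)) by [].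
    by apply: is_derive_eq.
  by rewrite /q k0 mulr0 expR0; lra.
move=> [ch Dh] h0 C0 dhC t tT; rewrite ler_norml; apply/andP; split.
  rewrite lerNl; apply: (side (fun s => - h s) (fun s => - dh s)) tT => //.
  - split=> [s|s s0 sT]; first exact: cvgN (ch s).
    by have ? := Dh s s0 sT; exact: is_deriveN.
  - by rewrite h0 oppr0.
  - move=> s s0 sT; apply: le_trans (dhC s s0 sT).
    by rewrite -normrN ler_norm.
apply: (side h dh) tT => // s s0 sT.
by apply: le_trans (dhC s s0 sT); exact: ler_norm.
Qed.

End Primitives.

Lemma within_continuous_comp (S T U : topologicalType) (A : set S)
    (x : S -> T) (F : T -> U) :
  {within A, continuous x} -> continuous F -> {within A, continuous (F \o x)}.
Proof.
move=> cx cF s.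
by apply: (@continuous_comp (subspace A) T U); [exact: cx|exact: cF].
Qed.
Arguments within_continuous_comp {S T U A x F}.

Section VectorPrimitives.
Context {R : realType} {n : nat}.

Lemma primitive_onB (T : \bar R) (x y w v : R -> 'rV[R]_n) :
  primitive_on T x w -> primitive_on T y v ->
  primitive_on T (x \- y) (w \- v).
Proof.
move=> [cx Dx] [cy Dy]; split=> [t|t t0 tT]; first exact: cvgB (cx t) (cy t).
have ? := Dx t t0 tT; have ? := Dy t t0 tT; exact: is_deriveB.
Qed.

Lemma rV_primitive_halving (T : \bar R) (z w : R -> 'rV[R]_n) (L C : R) :
  primitive_on T z w -> z 0 = 0 -> 0 <= C ->
  (forall t, 0 < t -> life T t -> `|w t| <= L * (C * expR (2 * L * t))) ->
  forall t, life T t -> `|z t| <= C / 2 * expR (2 * L * t).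
Proof.
move=> [cz Dz] z0 C0 wC t tT; apply: rV_norm_le => [|i].
  by rewrite mulr_ge0 ?divr_ge0 ?expR_ge0.
apply: (@primitive_halving R T (fun s => z s ord0 i) (fun s => w s ord0 i)) tT.
- split=> [s|s s0 sT]; last exact: is_derive_coord (Dz s s0 sT).
  apply: (within_continuous_comp cz (F := fun M : 'rV_n => M ord0 i)).
  exact: coord_continuous.
- by rewrite z0 mxE.
- exact: C0.
- by move=> s s0 sT; apply: le_trans (wC s s0 sT); exact: ler_coord_norm.
Qed.

Definition lipschitz_field (L : R) (g : 'rV[R]_n -> 'rV[R]_n) :=
  forall a b, `|g a - g b| <= L * `|a - b|.

Lemma lipschitz_field_continuous L g : lipschitz_field L g -> continuous g.
Proof.
move=> gL a; apply/(@cvgrPdist_le _ _ _ _ (nbhs_filter a)) => e e0.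
have L0 : 0 < `|L| + 1 by rewrite ltr_wpDl.
near=> b; apply: le_trans (gL a b) _.
apply: (@le_trans _ _ ((`|L| + 1) * `|a - b|)).
  by rewrite ler_wpM2r// (le_trans (ler_norm _))// lerDl.
rewrite -ler_pdivlMl// mulrC; near: b.
apply: (proj1 (@cvgrPdist_le _ _ _ _ (nbhs_filter a) id a) (@cvg_id _ _)).
by rewrite divr_gt0.
Unshelve. all: by end_near. Qed.

(** One Picard step [x' = g u] halves weighted distances.  This is used three
    times: for the convergence of the iterates, for the limit being a fixed
    point, and for uniqueness. *)
Lemma picard_contraction (T : \bar R) g (L C : R) (x y u v : R -> 'rV[R]_n) :
  lipschitz_field L g -> 0 <= L -> 0 <= C -> x 0 = y 0 ->
  primitive_on T x (g \o u) -> primitive_on T y (g \o v) ->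
  (forall t, life T t -> `|u t - v t| <= C * expR (2 * L * t)) ->
  forall t, life T t -> `|x t - y t| <= C / 2 * expR (2 * L * t).
Proof.
move=> gL L0 C0 xy0 Px Py uvC.
apply: (rV_primitive_halving (primitive_onB Px Py)) => // [|t t0 tT].
  by rewrite /= xy0 subrr.
by apply: le_trans (gL _ _) _; rewrite ler_wpM2l// uvC.
Qed.

Lemma halvings_le0 (a b : R) : (forall k, a <= b / 2 ^+ k) -> a <= 0.
Proof.
move=> ab; suff b0 : b / 2 ^+ k @[k --> \oo] --> (0 : R).
  rewrite -(cvg_lim (@Rhausdorff R) b0); apply: limr_ge; last exact: nearW.
  exact: cvgP b0.
have : geometric b 2^-1 k @[k --> \oo] --> (0 : R).
  by apply: cvg_geometric; rewrite gtr0_norm ?invf_lt1 ?ltr1n.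
apply: cvg_trans; apply: near_eq_cvg; near=> k.
by rewrite /geometric/= exprVn.
Unshelve. all: by end_near. Qed.

(** Two solutions at bounded distance are Picard iterates of themselves, so
    that their weighted distance is at most every halving of the bound. *)
Lemma primitive_unique (T : \bar R) g (L C : R) (x y : R -> 'rV[R]_n) :
  lipschitz_field L g -> 0 <= L -> x 0 = y 0 ->
  primitive_on T x (g \o x) -> primitive_on T y (g \o y) ->
  (forall t, life T t -> `|x t - y t| <= C) ->
  forall t, life T t -> x t = y t.
Proof.
move=> gL L0 xy0 Px Py xyC t tT.
have C0 : 0 <= C by apply: le_trans (xyC t tT).
apply/eqP; rewrite -subr_eq0 -normr_le0.
apply: (@halvings_le0 _ (C * expR (2 * L * t))) => k.
rewrite mulrAC; elim: k t tT => [|k IH] t tT.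
  rewrite expr0 divr1; apply: le_trans (xyC t tT) _.
  rewrite ler_peMr// -expR0 ler_expR mulr_ge0 ?mulr_ge0//.
  by case: tT.
rewrite exprS invfM [2^-1 * _]mulrC mulrA.
apply: (picard_contraction gL L0 _ xy0 Px Py IH) tT.
by rewrite divr_ge0// exprn_ge0.
Qed.

End VectorPrimitives.

(** * Antiderivatives of continuous functions *)

Section Antiderivative.
Context {R : realType}.
Local Notation mu := (@lebesgue_measure R).

Lemma dist_max_le (a b c : R) : `|Num.max a c - Num.max b c| <= `|a - b|.
Proof.
by case: (leP a c) => ?; case: (leP b c) => ?; rewrite !ler_norml;
  apply/andP; split; have := ler_norm (a - b); have := ler_norm (b - a);
  rewrite (distrC b a); lra.
Qed.

(** The derivative is needed only for positive times, but the function has to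
    be continuous on the whole line so that the construction can be iterated:
    an integral starting at [-1] is frozen at its value at 0 for negative
    times. *)
Lemma antiderivative (h : R -> R) : continuous h ->
  exists H : R -> R, [/\ continuous H, forall t : R, t <= 0 -> H t = 0 &
    forall t : R, 0 < t -> is_derive t 1 H (h t)].
Proof.
move=> ch; pose F y : R := (\int[mu]_(t in [set` `[-1, y]]) h t)%R.
have DF (t : R) : -1 < t -> is_derive t 1 F (h t).
  move=> t1; have [||||dF eF] := @continuous_FTC1_closed R h (-1) t (t + 1).
  - by rewrite ltrDl.
  - apply: continuous_compact_integrable; first exact: segment_compact.
    exact: continuous_subspaceT.
  - exact: t1.
  - exact: ch.
  - by apply: DeriveDef => //; rewrite -eF derive1E.
exists (fun t => F (Num.max t 0) - F 0); split=> [t|t t0|t t0].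
- apply: cvgB; last exact: cvg_cst.
  apply: (@cvg_comp _ _ _ (fun s => Num.max s 0) F _ (nbhs (Num.max t 0))).
    apply/cvgrPdist_le => e e0; near=> s.
    by apply: le_trans (dist_max_le t s 0) _; near: s; exact: cvgr_dist_le.
  apply: differentiable_continuous; apply/derivable1_diffP.
  have [//|//] := DF (Num.max t 0) _.
  by rewrite lt_max ltrN10 orbT.
- by rewrite max_r// subrr.
- apply: (@near_eq_is_derive _ _ _ (fun s => F s - F 0)).
    near=> s; rewrite max_l//; near: s; exact: lt_le_nbhsr.
  have ? := DF t (lt_trans (ltrN10 _) t0).
  by rewrite -[h t]subr0; exact: is_deriveB.
Unshelve. all: by end_near. Qed.

(** The intervals of radius [2 * C / 2 ^+ k] around [u k] are nested, and the
    limit is the supremum of their lower ends. *)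
Lemma cvg_halving_steps (u : nat -> R) (C : R) :
  (forall k, `|u k.+1 - u k| <= C / 2 ^+ k) ->
  exists l, forall k, `|u k - l| <= 2 * C / 2 ^+ k.
Proof.
move=> uC; pose d k := 2 * C / 2 ^+ k.
have dS k : d k = d k.+1 + C / 2 ^+ k.
  by rewrite /d exprS invfM; field; rewrite expf_neq0.
have near_tail k j : (k <= j)%N -> `|u j - u k| <= d k - d j.
  move=> /subnKC <-; elim: (j - k)%N => [|i IH].
    by rewrite addn0 !subrr normr0.
  rewrite addnS; have := uC (k + i)%N; have := dS (k + i)%N.
  move: IH; rewrite !ler_norml => /andP[? ?] ? /andP[? ?].
  by apply/andP; split; lra.
have d0 k : 0 <= d k.
  rewrite /d -mulrA mulr_ge0//; apply: le_trans (uC k); exact: normr_ge0.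
have lo k j : u k - d k <= u j + d j.
  case: (leqP k j) => [|/ltnW] /near_tail.
    by rewrite ler_norml => /andP[? ?]; have := d0 j; lra.
  by rewrite ler_norml => /andP[? ?]; have := d0 k; lra.
pose E := range (fun k => u k - d k).
exists (sup E) => k; rewrite ler_norml -/(d k).
have Eub j : ubound E (u j + d j) by move=> _ [i _ <-]; exact: lo.
have le_supE : u k - d k <= sup E.
  by apply: ub_le_sup; [exists (u 0%N + d 0%N)|exists k].
have supE_le : sup E <= u k + d k.
  by apply: ge_sup => //; exists (u 0%N - d 0%N), 0%N.
by apply/andP; split; lra.
Qed.

Context {n : nat}.

Lemma rV_antiderivative (x0 : 'rV[R]_n) (w : R -> 'rV[R]_n) : continuous w ->
  exists x : R -> 'rV[R]_n, [/\ continuous x, forall t : R, t <= 0 -> x t = x0 &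
    forall t : R, 0 < t -> is_derive t 1 x (w t)].
Proof.
move=> cw.
have /choice[H HP] i : exists H : R -> R, [/\ continuous H,
    forall t : R, t <= 0 -> H t = 0 &
    forall t : R, 0 < t -> is_derive t 1 H (w t ord0 i)].
  apply: antiderivative => t.
  apply: (@continuous_comp _ _ _ w (fun M : 'rV_n => M ord0 i)); first exact: cw.
  exact: coord_continuous.
exists (fun t => \row_i (x0 ord0 i + H i t)); split.
- apply: continuous_rV => i.
  under [fun t => _]funext do rewrite mxE.
  move=> t; apply: cvgD; first exact: cvg_cst.
  by have [cH _ _] := HP i; exact: cH.
- move=> t t0; apply/rowP => i; rewrite mxE.
  by have [_ -> // _] := HP i; rewrite addr0.
- move=> t t0; apply: is_derive_rV => i.
  under [fun t => _]funext do rewrite mxE.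
  have [_ _ /(_ t t0) DH] := HP i.
  by rewrite -[w t ord0 i]add0r; exact: is_deriveD.
Qed.

End Antiderivative.

(** * Global existence for globally Lipschitz fields *)

Section Existence.
Context {R : realType} {n : nat}.

Lemma global_primitive (x w : R -> 'rV[R]_n) :
  continuous x -> (forall t : R, 0 < t -> is_derive t 1 x (w t)) ->
  primitive_on +oo%E x w.
Proof.
by move=> cx Dx; split=> [|t t0 _]; [exact: continuous_subspaceT|exact: Dx].
Qed.

Lemma life_pinfty (t : R) : 0 <= t -> life +oo%E t.
Proof. by move=> t0; split => //; rewrite ltry. Qed.

(** Iterating [x |-> x0 + \int_0^t g (x s) ds] from the constant [x0], the
    steps are halved at each stage in the weight [expR (2 * L * t)], uniformly
    in [t >= 0]: the solution is global at once and no gluing of local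
    solutions is needed. *)
Lemma picard_lindelof (g : 'rV[R]_n -> 'rV[R]_n) (L : R) (x0 : 'rV[R]_n) :
  0 < L -> lipschitz_field L g ->
  exists x : R -> 'rV[R]_n, solution g +oo%E x /\ x 0 = x0.
Proof.
move=> L_gt0 gL; have L0 := ltW L_gt0.
have cg := lipschitz_field_continuous gL.
have /choice[P PP] (x : R -> 'rV[R]_n) : exists y : R -> 'rV[R]_n,
    continuous x -> [/\ continuous y, forall t : R, t <= 0 -> y t = x0 &
      forall t : R, 0 < t -> is_derive t 1 y (g (x t))].
  have [cx|ncx] := pselect (continuous x); last by exists x.
  have [|y yP] := @rV_antiderivative R n x0 (g \o x).
    by move=> t; apply: continuous_comp; [exact: cx|exact: cg].
  by exists y.
pose X k := iter k P (fun=> x0).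
have cX k : continuous (X k).
  by elim: k => [|k IH]; [exact: cst_continuous|have [] := PP _ IH].
have X_init k t : t <= 0 -> X k t = x0.
  by case: k => // k t0; have [_ Xi _] := PP _ (cX k); exact: Xi.
have X_prim k : primitive_on +oo%E (X k.+1) (g \o X k).
  by have [? _ DX] := PP _ (cX k); exact: global_primitive.
(* The first step is a primitive of [g x0], whose norm is [L * C]. *)
pose C := `|g x0| / L.
have C0 : 0 <= C by rewrite divr_ge0.
have LC : L * C = `|g x0| by rewrite mulrC divfK ?gt_eqF.
clearbody C.
pose E t := expR (2 * L * t).
have E0 t : 0 <= E t by exact: expR_ge0.
have X_step k t : 0 <= t -> `|X k.+1 t - X k t| <= C / 2 ^+ k.+1 * E t.
  move=> /life_pinfty; elim: k t => [|k IH] t tT.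
    have P0 : primitive_on +oo%E (X 0%N) (fun=> 0).
      by apply: global_primitive (cX 0%N) _ => s _; exact: is_derive_cst.
    apply: (rV_primitive_halving (primitive_onB (X_prim 0%N) P0)) tT => //.
      by rewrite /= [P _ _](X_init 1%N)// subrr.
    move=> s s0 _; rewrite /= subr0 mulrA LC.
    by rewrite ler_peMr// -expR0 ler_expR mulr_ge0 ?mulr_ge0// ltW.
  rewrite exprSr invfM mulrA.
  apply: (picard_contraction gL L0 _ _ (X_prim k.+1) (X_prim k) IH) tT.
    by rewrite divr_ge0 ?exprn_ge0.
  by rewrite !X_init.
(* The iterates are constant for negative times; the bound below holds for all
   times and is monotone in [`|t|], hence locally uniform. *)
have X_step' k t : `|X k.+1 t - X k t| <= C * E `|t| / 2 ^+ k.
  have [t0|/ltW t0] := leP 0 t; last first.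
    by rewrite !X_init// subrr normr0 divr_ge0 ?mulr_ge0 ?E0 ?exprn_ge0//.
  apply: le_trans (X_step k t t0) _; rewrite ger0_norm// mulrAC.
  rewrite ler_wpM2l ?mulr_ge0 ?E0// lef_pV2 ?posrE ?exprn_gt0//.
  by rewrite ler_eXn2l ?ltr1n.
have /choice[x xP] t : exists l : 'rV[R]_n,
    forall k, `|X k t - l| <= 2 * (C * E `|t|) / 2 ^+ k.
  have /choice[l lP] i : exists l : R, forall k,
      `|X k t ord0 i - l| <= 2 * (C * E `|t|) / 2 ^+ k.
    apply: cvg_halving_steps => k; apply: le_trans (X_step' k t).
    by have := ler_coord_norm (X k.+1 t - X k t) i; rewrite !mxE.
  exists (\row_i l i) => k; apply: rV_norm_le => [|i].
    by rewrite divr_ge0 ?mulr_ge0 ?E0 ?exprn_ge0.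
  by rewrite !mxE.
have cx : continuous x.
  move=> t; apply/cvgrPdist_le => e e0.
  pose B := 2 * (C * E (`|t| + 1)).
  have B0 : 0 <= B by rewrite !mulr_ge0 ?E0.
  have [k Bk] : exists k, B / 2 ^+ k <= e / 3.
    apply: contrapT => /forallNP noK.
    suff : e / 3 <= 0 by rewrite leNgt divr_gt0.
    apply: (@halvings_le0 _ _ B) => k.
    by have /negP := noK k; rewrite -ltNge => /ltW.
  have xB s : `|s| <= `|t| + 1 -> `|X k s - x s| <= e / 3.
    move=> st; apply: le_trans (xP s k) (le_trans _ Bk).
    rewrite ler_wpM2r ?invr_ge0 ?exprn_ge0// /B !ler_wpM2l// ler_expR.
    by rewrite ler_wpM2l// mulr_ge0.
  near=> s.
  have -> : x t - x s = (x t - X k t) + (X k t - X k s) + (X k s - x s).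
    by rewrite !addrA !subrK.
  apply: le_trans (ler_normD _ _) _; apply: le_trans (lerD (ler_normD _ _) _) _.
    exact: lexx.
  have -> : e = e / 3 + e / 3 + e / 3 by lra.
  rewrite !lerD//.
  - by rewrite distrC xB// lerDl.
  - near: s; have /cvgrPdist_le := cX k t; apply.
    by rewrite divr_gt0.
  - apply: xB; have : `|t - s| <= 1.
      by near: s; apply: (proj1 (@cvgrPdist_le _ _ _ _ _ id t) (@cvg_id _ _)).
    have := ler_normB t (t - s); rewrite opprB addrC subrK.
    by lra.
have [y0 y_prim] : (P x 0 = x0) /\ primitive_on +oo%E (P x) (g \o x).
  have [cy yi Dy] := PP _ cx.
  by split; [exact: yi|exact: global_primitive].
have x_init : x 0 = x0.
  apply/eqP; rewrite eq_sym -subr_eq0 -normr_le0.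
  apply: halvings_le0 => k; rewrite -(X_init k 0)//; exact: (xP 0 k).
(* [P x] and [x] are both at distance [O(2 ^- k)] from the iterate [X k.+1]. *)
have fixed t : 0 <= t -> P x t = x t.
  move=> t0; apply/eqP; rewrite -subr_eq0 -normr_le0.
  apply: (@halvings_le0 _ _ (2 * (2 * (C * E t)))) => k.
  have -> : P x t - x t = (P x t - X k.+1 t) + (X k.+1 t - x t).
    by rewrite addrA subrK.
  rewrite -[leRHS]mulrA mulrDl mul1r; apply: le_trans (ler_normD _ _) _.
  apply: lerD; last first.
    apply: le_trans (xP t k.+1) _; rewrite ger0_norm//.
    rewrite ler_wpM2l ?mulr_ge0 ?E0// lef_pV2 ?posrE ?exprn_gt0//.
    by rewrite ler_eXn2l ?ltr1n.
  rewrite distrC.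
  have : life +oo%E t by exact: life_pinfty.
  have C'0 : 0 <= 2 * C / 2 ^+ k by rewrite divr_ge0 ?mulr_ge0 ?exprn_ge0.
  move=> /(picard_contraction gL L0 C'0 _ (X_prim k) y_prim) close.
  apply: le_trans (close _ _) _.
  - by rewrite X_init.
  - move=> s [s0 _]; apply: le_trans (xP s k) _.
    by rewrite ger0_norm// mulrA mulrAC.
  - rewrite -/(E t) [2 * (C * E t)]mulrA [leRHS]mulrAC ler_wpM2r//.
    by rewrite ler_pdivrMr// ler_peMr// ler1n.
exists (P x); split; last exact: y0.
have [cy Dy] := y_prim; split=> [||t t0 tT] => //.
by rewrite fixed ?ltW//; apply: Dy => //; exact/life_pinfty/ltW.
Unshelve. all: by end_near. Qed.

End Existence.

(** * Cutting off a polynomial field *)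

Section Cutoff.
Context {R : realType} {n : nat}.
Implicit Types (F G : 'rV[R]_n -> R).

(** Boundedness is what makes products of Lipschitz functions Lipschitz. *)
Definition bounded_lipschitz F :=
  exists K, forall a b, `|F a| <= K /\ `|F a - F b| <= K * `|a - b|.

Lemma bounded_lipschitz_cst (c : R) : bounded_lipschitz (fun=> c).
Proof. by exists `|c| => a b; rewrite subrr normr0 mulr_ge0. Qed.

Lemma bounded_lipschitzD F G : bounded_lipschitz F -> bounded_lipschitz G ->
  bounded_lipschitz (fun x => F x + G x).
Proof.
move=> [K FK] [M GM]; exists (K + M) => a b.
have [Fa Fab] := FK a b; have [Ga Gab] := GM a b; split.
  exact: le_trans (ler_normD _ _) (lerD Fa Ga).
rewrite opprD addrACA mulrDl.
exact: le_trans (ler_normD _ _) (lerD Fab Gab).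
Qed.

Lemma bounded_lipschitzM F G : bounded_lipschitz F -> bounded_lipschitz G ->
  bounded_lipschitz (fun x => F x * G x).
Proof.
move=> [K FK] [M GM]; exists (K * M + K * M) => a b.
have [Fa Fab] := FK a b; have [Ga Gab] := GM a b; have [Gb _] := GM b b.
have K0 : 0 <= K by apply: le_trans Fa.
have M0 : 0 <= M by apply: le_trans Ga.
split.
  by rewrite normrM (le_trans (ler_pM _ _ Fa Ga))// lerDl mulr_ge0.
have -> : F a * G a - F b * G b = F a * (G a - G b) + (F a - F b) * G b by ring.
rewrite [leRHS]mulrDl; apply: le_trans (ler_normD _ _) _; rewrite !normrM lerD//.
  by rewrite -mulrA ler_pM.
by rewrite mulrAC ler_pM.
Qed.

Lemma bounded_lipschitz_big (op : R -> R -> R) (idx : R) :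
  (forall F G, bounded_lipschitz F -> bounded_lipschitz G ->
     bounded_lipschitz (fun x => op (F x) (G x))) ->
  forall (I : Type) (s : seq I) (F : I -> 'rV[R]_n -> R),
    (forall i, bounded_lipschitz (F i)) ->
    bounded_lipschitz (fun x => \big[op/idx]_(i <- s) F i x).
Proof.
move=> closed_op I s F BF; elim: s => [|i s IH].
  under [fun x => _]funext do rewrite big_nil.
  exact: bounded_lipschitz_cst.
under [fun x => _]funext do rewrite big_cons.
exact: closed_op.
Qed.

Lemma bounded_lipschitz_meval (p : mpoly.mpoly n R)
    (v : 'I_n -> 'rV[R]_n -> R) : (forall i, bounded_lipschitz (v i)) ->
  bounded_lipschitz (fun x => mpoly.meval (fun i => v i x) p).
Proof.
move=> Bv; under [fun x => _]funext do rewrite mpoly.mevalE.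
apply: bounded_lipschitz_big => [|m]; first exact: bounded_lipschitzD.
apply: bounded_lipschitzM; first exact: bounded_lipschitz_cst.
apply: bounded_lipschitz_big => [|i]; first exact: bounded_lipschitzM.
elim: (mpoly.fun_of_multinom m i) => [|k IH]; first exact: bounded_lipschitz_cst.
under [fun x => _]funext do rewrite exprS.
exact: bounded_lipschitzM.
Qed.

(** This is the truncation of [t] to the interval from [- c] to [c], written with
    maxima only so that [dist_max_le] gives its Lipschitz bound. *)
Definition clamp (c t : R) := - Num.max (- Num.max t (- c)) (- c).

Lemma clamp_id (c t : R) : `|t| <= c -> clamp c t = t.
Proof.
rewrite ler_norml => /andP[ct tc].
by rewrite /clamp (max_l ct) max_l ?opprK// lerN2.
Qed.

Lemma bounded_lipschitz_clamp (c : R) i : 0 <= c ->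
  bounded_lipschitz (fun x => clamp c (x ord0 i)).
Proof.
move=> c0; exists (c + 1) => a b; split.
  rewrite /clamp; set m := Num.max (a ord0 i) (- c).
  have : - c <= m by rewrite le_max lexx orbT.
  by rewrite ler_norml; case: (leP (- m) (- c)) => ? ?; apply/andP; split; lra.
have /le_trans := ler_coord_norm (a - b) i; rewrite !mxE => ab.
apply: (@le_trans _ _ `|a ord0 i - b ord0 i|); last first.
  by apply: ab; rewrite ler_peMl// lerDr.
rewrite /clamp -opprD normrN; apply: le_trans (dist_max_le _ _ _) _.
by rewrite -opprD normrN; exact: dist_max_le.
Qed.

Definition bump (r : R) (x : 'rV[R]_n) := Num.max (1 - Num.max (`|x| - r) 0) 0.

Lemma bump_ge0 r x : 0 <= bump r x.
Proof. by rewrite le_max lexx orbT. Qed.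

Lemma bump1 (r : R) x : `|x| <= r -> bump r x = 1.
Proof. by move=> xr; rewrite /bump [X in 1 - X]max_r ?subr_le0// subr0 max_l. Qed.

Lemma bump0 (r : R) x : r + 1 <= `|x| -> bump r x = 0.
Proof.
move=> xr; rewrite /bump max_r// subr_le0 le_max lerBrDl.
by rewrite xr.
Qed.

Lemma bounded_lipschitz_bump (r : R) : bounded_lipschitz (bump r).
Proof.
exists 1 => a b; rewrite mul1r; split.
  rewrite ger0_norm ?bump_ge0// ge_max ler01 andbT.
  by rewrite lerBlDr lerDl le_max lexx orbT.
apply: le_trans (dist_max_le _ _ _) _.
rewrite opprD addrACA subrr add0r -opprD normrN.
apply: le_trans (dist_max_le _ _ _) _.
rewrite opprD addrACA subrr addr0.
exact: ler_dist_dist.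
Qed.

(** A polynomial is in general Lipschitz only locally.  Multiplying it by a bump
    function makes it globally Lipschitz and only rescales its values by a factor
    between 0 and 1, so that the sign of an orbital derivative is preserved. *)
Lemma polynomial_cutoff (f : 'rV[R]_n -> 'rV[R]_n) (r : R) :
  polynomial_field f -> 0 <= r ->
  exists2 L, 0 < L & lipschitz_field L (fun x => bump r x *: f x).
Proof.
move=> [p fp] r0; have r1 : 0 <= r + 1 by rewrite addr_ge0.
have /choice[K KP] i : bounded_lipschitz
    (fun x => bump r x * mpoly.meval (fun j => clamp (r + 1) (x ord0 j)) (p i)).
  apply: bounded_lipschitzM; first exact: bounded_lipschitz_bump.
  by apply: bounded_lipschitz_meval => j; exact: bounded_lipschitz_clamp.
have K0 i : 0 <= K i by have [/(le_trans (normr_ge0 _))] := KP i 0 0.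
exists (1 + \sum_i K i) => [|a b].
  by rewrite ltr_pwDl// sumr_ge0.
apply: rV_norm_le => [|i].
  by rewrite mulr_ge0// addr_ge0// sumr_ge0.
(* Outside the ball of radius [r + 1] the bump vanishes, and inside that ball
   clamping the coordinates at [r + 1] changes nothing. *)
have fE x : bump r x * f x ord0 i =
    bump r x * mpoly.meval (fun j => clamp (r + 1) (x ord0 j)) (p i).
  have [xr|/ltW /bump0 ->] := leP `|x| (r + 1); last by rewrite !mul0r.
  rewrite fp; congr *%R; apply: mpoly.meval_eq => j.
  by rewrite clamp_id// (le_trans (ler_coord_norm _ _)).
rewrite !mxE !fE; have [_] := KP i a b; move/le_trans; apply.
rewrite ler_wpM2r// (bigD1 i)//= addrCA lerDl addr_ge0// sumr_ge0//.
Qed.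

End Cutoff.

(** * Lyapunov functions *)

Section Lyapunov.
Context {R : realType} {n : nat}.
Implicit Types (V : 'rV[R]_n -> R) (f g : 'rV[R]_n -> 'rV[R]_n).

Lemma is_derive_along V (x : R -> 'rV[R]_n) (t : R) (v : 'rV[R]_n) :
  differentiable V (x t) -> is_derive t 1 x v ->
  is_derive t 1 (V \o x) (inner_product (gradient V (x t)) v).
Proof.
move=> dV [dx Dx]; have dx' : differentiable x t by exact/derivable1_diffP.
have dVx : differentiable (V \o x) t by exact: differentiable_comp.
apply: DeriveDef; first exact/derivable1_diffP.
rewrite deriveE// diff_comp//= -[X in 'd V _ X]deriveE// Dx.
rewrite {1}(row_sum_delta v) linear_sum; apply: eq_bigr => j _.
by rewrite linearZ/= -deriveE// mxE mulrC.
Qed.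

Lemma orbital_derivativeZ V (a : 'rV[R]_n -> R) f (x : 'rV[R]_n) :
  orbital_derivative V (fun y => a y *: f y) x = a x * orbital_derivative V f x.
Proof.
rewrite /orbital_derivative /inner_product mulr_sumr.
by apply: eq_bigr => i _; rewrite !mxE mulrCA.
Qed.

Lemma orbital_derivative_continuous V f :
  continuous (gradient V) -> continuous f -> continuous (orbital_derivative V f).
Proof.
have coordC (h : 'rV[R]_n -> 'rV[R]_n) i :
    continuous h -> continuous (fun y => h y ord0 i).
  move=> ch y; apply: (@continuous_comp _ _ _ h (fun M : 'rV_n => M ord0 i)).
    exact: ch.
  exact: coord_continuous.
move=> cV cf; rewrite /orbital_derivative /inner_product.
apply: continuous_big => [|i _ y]; first exact: (@add_continuous R^o).
by apply: (@cvgM _ _ _ (nbhs_filter y)); exact: (coordC _ i _ y).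
Qed.

(** The derivative of [V] along the straight line through [c] in the direction
    [f c] vanishes at the interior minimum [c]. *)
Lemma orbital_derivative_at_min V f (c : 'rV[R]_n) :
  (forall x, differentiable V x) -> (forall x, V c <= V x) ->
  orbital_derivative V f c = 0.
Proof.
move=> dV minc; pose ray (t : R) := c + t *: f c.
have Dray (t : R) : is_derive t 1 ray (f c).
  rewrite -[f c]add0r; apply: is_deriveD.
  have : is_derive t (1 : R) (fun s : R => s *: f c) (1 *: f c).
    have [ds ds1] := is_diff_scalel t (f c).
    by apply: DeriveDef; [exact/derivable1_diffP|rewrite deriveE// ds1].
  by rewrite scale1r.
have DV (t : R) := is_derive_along (dV (ray t)) (Dray t).
have [|t _||t _|_ e] := @derive1_at_min R (V \o ray) (-1) 1 0.
- by lra.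
- by have [] := DV t.
- by rewrite in_itv/= ltrN10 ltr01.
- by rewrite /ray/= scale0r addr0.
have [_] := DV 0; rewrite e /ray scale0r addr0.
by move=> /esym.
Qed.

(** Beyond some radius [V] exceeds its value at a point of [A], so that the
    minimum over [A] is the one over a compact part of [A]. *)
Lemma coercive_min V (A : set 'rV[R]_n) : continuous V ->
  radially_unbounded V -> closed A -> A !=set0 ->
  exists2 c, A c & forall x, A x -> V c <= V x.
Proof.
move=> cV rV clA [a Aa]; have [r rP] := rV (V a + 1).
have far x : V x <= V a -> `|x| <= r.
  move=> xa; rewrite leNgt; apply/negP => /ltW /rP; lra.
have Kc : compact (A `&` [set x | `|x| <= r]).
  apply: bounded_closed_compact.
    exists r; split; first exact: num_real.
    by move=> M rM x [_ /= /le_trans]; apply; exact: ltW.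
  apply: closedI => //.
  apply: (@closed_comp _ _ (fun x : 'rV[R]_n => `|x|) [set t | t <= r]).
    by move=> x _; exact: norm_continuous.
  exact: closed_le.
have [|c cK cmin] := EVT_min_rV _ Kc (continuous_subspaceT cV).
  by exists a; split=> //; exact: far.
have [Ac cr] : (A `&` [set x | `|x| <= r]) c by exact: set_mem.
exists c => // x Ax.
have [xr|rx] := leP `|x| r; first by apply: cmin; exact/mem_set.
have ac : V c <= V a.
  by apply: cmin; apply/mem_set; split=> //; exact: far.
by have := rP x (ltW rx); lra.
Qed.

(** This replaces the assumption that [V] is positive definite: [V] has a
    global minimizer, where its orbital derivative must vanish, hence every
    global minimizer is the origin. *)
Lemma lyapunov_strict_min V f :
  continuously_differentiable V -> radially_unbounded V ->
  (forall x, x != 0 -> orbital_derivative V f x < 0) ->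
  forall x, x != 0 -> V 0 < V x.
Proof.
move=> [dV _] rV Vf.
have cV : continuous V by move=> x; exact: differentiable_continuous.
have min0 c : (forall x, V c <= V x) -> c = 0.
  move=> minc; apply/eqP; apply: contraT => /Vf.
  by rewrite orbital_derivative_at_min// ltxx.
have [c _ minc] : exists2 c, setT c & forall x, setT x -> V c <= V x.
  by apply: coercive_min => //; exists 0.
have c0 : c = 0 by apply: min0 => x; exact: minc.
move=> x x0; rewrite ltNge; apply: contra x0 => Vx0; apply/eqP/min0 => y.
by apply: le_trans Vx0 _; rewrite -c0; exact: minc.
Qed.

(** The sublevel sets of [V] shrink to the origin as the level decreases to
    [V 0].  Minimizing over the whole exterior of the ball rather than over its
    boundary makes any trajectory with [V < m] stay in the ball without an
    intermediate value argument. *)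
Lemma lyapunov_barrier V (e : R) : continuous V -> radially_unbounded V ->
  (forall x, x != 0 -> V 0 < V x) -> 0 < e ->
  exists2 m, V 0 < m & forall x, e <= `|x| -> m <= V x.
Proof.
move=> cV rV V0 e0.
have [ne|empty] := pselect ([set x : 'rV[R]_n | e <= `|x|] !=set0); last first.
  exists (V 0 + 1) => [|x ex]; first by rewrite ltrDl.
  by exfalso; apply: empty; exists x.
have [|c /= ec cmin] := coercive_min cV rV _ ne.
  apply: (@closed_comp _ _ (fun x : 'rV[R]_n => `|x|) [set t | e <= t]).
    by move=> x _; exact: norm_continuous.
  exact: closed_ge.
exists (V c) => //; apply: V0; apply: contraTneq ec => ->.
by rewrite normr0 -ltNge.
Qed.

Lemma lyapunov_primitive V g (T : \bar R) (x : R -> 'rV[R]_n) :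
  (forall x, differentiable V x) -> solution g T x ->
  primitive_on T (V \o x) (orbital_derivative V g \o x).
Proof.
move=> dV [T0 cx Dx]; split=> [|t t0 [_ tT]].
  by apply: within_continuous_comp cx _ => y; exact: differentiable_continuous.
exact: is_derive_along (Dx t t0 tT).
Qed.

Lemma lyapunov_decrease V g (T : \bar R) (x : R -> 'rV[R]_n) (s t : R) :
  (forall x, differentiable V x) -> (forall x, orbital_derivative V g x <= 0) ->
  solution g T x -> 0 <= s -> s <= t -> life T t -> V (x t) <= V (x s).
Proof.
move=> dV Vg sx s0 st tT.
apply: (le_of_derive_le0 (lyapunov_primitive dV sx)) s0 st tT => u _ _.
exact: Vg.
Qed.

End Lyapunov.

(** * Stability and global attraction *)

Section GlobalAsymptoticStability.
Context {R : realType} {n : nat}.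
Variables (f : 'rV[R]_n -> 'rV[R]_n) (V : 'rV[R]_n -> R).
Hypothesis f_poly : polynomial_field f.
Hypothesis f0 : f 0 = 0.
Hypothesis V_C1 : continuously_differentiable V.
Hypothesis V_unbounded : radially_unbounded V.
Hypothesis Vf_lt0 : forall x, x != 0 -> orbital_derivative V f x < 0.

Let V_diff : forall x, differentiable V x := V_C1.1.

Let V_cont : continuous V.
Proof. by move=> x; exact: differentiable_continuous. Qed.

Let V_min : forall x, x != 0 -> V 0 < V x.
Proof. exact: lyapunov_strict_min Vf_lt0. Qed.

Lemma orbital_derivative_le0 x : orbital_derivative V f x <= 0.
Proof.
have [->|/Vf_lt0/ltW//] := eqVneq x 0.
rewrite /orbital_derivative f0 /inner_product big1// => i _.
by rewrite !mxE mulr0.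
Qed.

Lemma lyapunov_stable_field : lyapunov_stable f.
Proof.
move=> e e0; have [m m0 far] := lyapunov_barrier V_cont V_unbounded V_min e0.
have := @V_cont 0; move=> /(@cvgrPdist_lt _ _ _ _ (nbhs_filter _)).
move=> /(_ (m - V 0)); rewrite subr_gt0 => /(_ m0) /nbhs_ballP[d /= d0 near0].
exists d => // T x sx xd t t0 tT; rewrite ltNge; apply/negP => /far mVx.
have Vxt : V (x t) <= V (x 0).
  by apply: (lyapunov_decrease V_diff orbital_derivative_le0 sx).
have /near0 /= : ball (0 : 'rV[R]_n) d (x 0).
  by rewrite -ball_normE/= sub0r normrN.
by rewrite ltr_norml => /andP[? _]; lra.
Qed.

Lemma sublevel_bounded (c : R) :
  exists2 r, 0 <= r & forall x, V x <= c -> `|x| <= r.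
Proof.
have [r rP] := V_unbounded (c + 1); exists `|r| => // x Vx.
rewrite (le_trans _ (ler_norm r))// leNgt; apply/negP => /ltW /rP; lra.
Qed.

Lemma solution_bounded (T : \bar R) (x : R -> 'rV[R]_n) (r : R) :
  (forall y, V y <= V (x 0) -> `|y| <= r) -> solution f T x ->
  forall t, life T t -> `|x t| <= r.
Proof.
move=> rP sx t tT; apply: rP.
by apply: (lyapunov_decrease V_diff orbital_derivative_le0 sx) => //; case: tT.
Qed.

(** Solve the equation for the field cut off outside a ball containing the
    sublevel set of [V x0].  [V] decreases along that solution as well, which
    therefore never leaves the ball and solves the original equation. *)
Lemma global_solution (x0 : 'rV[R]_n) :
  exists2 x : R -> 'rV[R]_n, solution f +oo%E x & x 0 = x0.
Proof.
have [r r0 rP] := sublevel_bounded (V x0).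
have [L L0 gL] := polynomial_cutoff f_poly r0.
have [x [sx xi]] := picard_lindelof x0 L0 gL.
exists x => //; have [T0 cx Dx] := sx; split=> // t t0 tT.
have := Dx t t0 tT; rewrite bump1 ?scale1r//; apply: rP; rewrite -xi.
apply: (lyapunov_decrease V_diff _ sx) => // [y||].
- by rewrite orbital_derivativeZ mulr_ge0_le0 ?bump_ge0 ?orbital_derivative_le0.
- exact: ltW.
- exact/life_pinfty/ltW.
Qed.

(** Both solutions stay in the sublevel set of their initial value, where the
    field agrees with a globally Lipschitz one. *)
Lemma unique_solution (T : \bar R) (x y : R -> 'rV[R]_n) :
  solution f T x -> solution f T y -> x 0 = y 0 ->
  forall t, life T t -> x t = y t.
Proof.
move=> sx sy xy0; have [r r0 rP] := sublevel_bounded (V (x 0)).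
have [L L0 gL] := polynomial_cutoff f_poly r0.
have xr := solution_bounded rP sx.
have yr := @solution_bounded T y r; rewrite -xy0 in yr.
have {}yr := yr rP sy.
have prim z : solution f T z -> (forall t, life T t -> `|z t| <= r) ->
    primitive_on T z ((fun x => bump r x *: f x) \o z).
  move=> [T0 cz Dz] zr; split=> // t t0 tT.
  by rewrite /= bump1 ?zr// scale1r; apply: Dz => //; case: tT.
have := primitive_unique gL (ltW L0) xy0 (prim x sx xr) (prim y sy yr).
apply=> t tT; apply: le_trans (ler_normB _ _) _.
by apply: lerD; [exact: xr|exact: yr].
Qed.

(** If [V (x t)] stayed above a level [m > V 0], the trajectory would remain in
    a compact set avoiding the origin, on which the orbital derivative is at
    most some [- d < 0]; then [V (x t)] would decrease without bound. *)
Lemma global_solution_cvg (x : R -> 'rV[R]_n) : solution f +oo%E x ->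
  x t @[t --> +oo] --> (0 : 'rV[R]_n).
Proof.
move=> sx; apply/cvgrPdist_lt => e e0.
have [m m0 far] := lyapunov_barrier V_cont V_unbounded V_min e0.
have V_noninc (s t : R) : 0 <= s -> s <= t -> V (x t) <= V (x s).
  move=> s0 st; apply: (lyapunov_decrease V_diff orbital_derivative_le0 sx) => //.
  by apply: life_pinfty; exact: le_trans st.
suff [s s0 sm] : exists2 s, 0 <= s & V (x s) < m.
  near=> t; rewrite sub0r normrN ltNge; apply/negP => /far mVt.
  have : V (x t) <= V (x s).
    by apply: V_noninc => //; near: t; exact: nbhs_pinfty_ge (num_real _).
  by rewrite leNgt (lt_le_trans sm).
apply: contrapT => stuck.
have Vge (t : R) : 0 <= t -> m <= V (x t).
  by move=> t0; rewrite leNgt; apply/negP => tm; apply: stuck; exists t.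
pose A : set 'rV[R]_n := [set y | m <= V y /\ V y <= V (x 0)].
have xA (t : R) : 0 <= t -> A (x t).
  by move=> t0; split; [exact: Vge|exact: V_noninc].
have [r r0 rP] := sublevel_bounded (V (x 0)).
have [L L0 gL] := polynomial_cutoff f_poly r0.
have Ac : compact A.
  apply: bounded_closed_compact.
    exists r; split; first exact: num_real.
    by move=> M rM y [_ /rP yr]; exact: le_trans (ltW rM).
  apply: (@closedI _ [set y | m <= V y] [set y | V y <= V (x 0)]).
    apply: (@closed_comp _ _ V [set u | m <= u]); last exact: closed_ge.
    by move=> y _; exact: V_cont.
  apply: (@closed_comp _ _ V [set u | u <= V (x 0)]); last exact: closed_le.
  by move=> y _; exact: V_cont.
pose g y := bump r y *: f y.
have gf y : A y -> orbital_derivative V g y = orbital_derivative V f y.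
  by move=> [_ /rP yr]; rewrite orbital_derivativeZ bump1// mul1r.
(* On [A] the field may be replaced by its cutoff, whose continuity comes with
   the Lipschitz bound. *)
have cont_Vg : continuous (orbital_derivative V g).
  apply: orbital_derivative_continuous V_C1.2 _.
  exact: lipschitz_field_continuous gL.
have [|c /set_mem cA cmax] := EVT_max_rV _ Ac (continuous_subspaceT cont_Vg).
  by exists (x 0); exact: xA.
pose d := - orbital_derivative V f c.
have d0 : 0 < d.
  rewrite oppr_gt0 Vf_lt0//; apply: contraTneq m0 => c0; rewrite -leNgt -c0.
  by case: cA.
have Vx_le (t : R) : 0 <= t -> V (x t) + d * t <= V (x 0).
  move=> t0; have [cVx DVx] := lyapunov_primitive V_diff sx.
  have prim : primitive_on +oo%E (fun s : R => V (x s) + d * s)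
      (fun s => orbital_derivative V f (x s) + d).
    split=> [s|s s0 sT].
      apply: cvgD; first exact: cVx.
      apply: continuous_subspaceT => u; apply: cvgM; first exact: cvg_cst.
      exact: cvg_id.
    apply: is_deriveD; first exact: DVx.
    by have := is_deriveZ d (is_derive_id s (1 : R)); rewrite /GRing.scale/= mulr1.
  have -> : V (x 0) = V (x 0) + d * 0 by rewrite mulr0 addr0.
  apply: (le_of_derive_le0 prim) => //; last exact: life_pinfty.
  move=> s s0 _; rewrite -lerBrDr sub0r /d opprK.
  have xsA := xA s (ltW s0).
  by rewrite -gf// -(gf c)//; apply: cmax; exact/mem_set.
(* At this time the bound [V (x 0) - d * t] has come down to [V 0 < m]. *)
have t0 : 0 <= (V (x 0) - V 0) / d.
  rewrite divr_ge0 ?(ltW d0)// subr_ge0.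
  by have := Vge 0 (lexx _); lra.
have := Vx_le _ t0; rewrite [d * _]mulrC divfK ?gt_eqF//.
by have := Vge _ t0; lra.
Unshelve. all: by end_near. Qed.

(** A solution on [0, T[ coincides there with the global one, which therefore
    extends it: a maximal solution has [T = +oo]. *)
Lemma globally_attractive_field : globally_attractive f.
Proof.
move=> x0; split; first exact: global_solution.
move=> T x [sx xmax] xi; have [y sy yi] := global_solution x0.
have Too : +oo%E = T.
  apply: (xmax +oo%E y sy) => [|t t0 tT]; first exact: leey.
  apply/esym; apply: (@unique_solution T) => //; last by rewrite xi yi.
  have [_ cy Dy] := sy; have [T0 _ _] := sx; split=> //.
    by apply: continuous_subspaceW cy => s [s0 _]; exact: life_pinfty.
  by move=> s s0 _; apply: Dy => //; rewrite ltry.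
split=> //; apply: global_solution_cvg; by rewrite Too.
Qed.

End GlobalAsymptoticStability.

Theorem proposition4p1 (R : realType) (n : nat)
    (f : 'rV[R]_n -> 'rV[R]_n) (hf : polynomial_field f) (hf0 : f 0 = 0) :
  (exists V : 'rV[R]_n -> R,
     [/\ continuously_differentiable V,
         radially_unbounded V &
         forall x : 'rV[R]_n, x != 0 -> orbital_derivative V f x < 0]) ->
  globally_asymptotically_stable f.
Proof.
move=> [V [V_C1 V_unbounded Vf_lt0]]; split.
  exact: lyapunov_stable_field hf0 V_C1 V_unbounded Vf_lt0.
exact: globally_attractive_field hf hf0 V_C1 V_unbounded Vf_lt0.
Qed.
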